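(* Let $R$ be a $G$-graded ring, let $M$ be a graded multiplication faithful $R$-module and let $K$ be a graded $R$-submodule of $M$. If $(K:_RM)$ is a graded semi-essential ideal of $R$, then $K$ is a graded semi-essential $R$-submodule of $M$.
   Context: $G$ is a group; a ring $R$ with unity is $G$-graded if $R=\bigoplus_{g\in G}R_g$ for additive subgroups with $R_gR_h\subseteq R_{gh}$; a left $R$-module $M$ is graded if $M=\bigoplus_{g\in G}M_g$ for additive subgroups with $R_gM_h\subseteq M_{gh}$. $h(R)=\bigcup_g R_g$, $h(M)=\bigcup_g M_g$. An ideal $I$ of $R$ is graded if $I=\bigoplus_g(I\cap R_g)$; a submodule $N$ of $M$ is graded if $N=\bigoplus_{g}(N\cap M_g)$. $(N:_RM)=\{r\in R: rM\subseteq N\}$, which is a graded ideal if $N$ is a graded submodule. $M$ is faithful if $\{r\in R: rM=0\}=\{0\}$. $M$ is graded multiplication if every graded submodule $N$ of $M$ has the form $N=IM$ for some graded ideal $I$ of $R$ (one may then take $I=(N:_RM)$). A proper graded ideal $B$ of $R$ is graded prime if $a,b\in h(R)$, $ab\in B$ implies $a\in B$ or $b\in B$. A proper graded submodule $P$ of $M$ is graded prime if whenever $r\in h(R)$, $m\in h(M)$ and $rm\in P$, then $m\in P$ or $r\in(P:_RM)$. A nonzero graded ideal $I$ of $R$ is graded semi-essential if $I\cap B\neq\{0\}$ for every nonzero graded prime ideal $B$ of $R$. A nonzero graded submodule $K$ of $M$ is graded semi-essential if $K\cap P\neq\{0\}$ for every nonzero graded prime submodule $P$ of $M$. *)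

(* Defs.v *)
From mathcomp Require Import all_boot all_algebra.
From mathcomp Require Import boolp classical_sets.

Set Implicit Arguments.
Unset Strict Implicit.
Unset Printing Implicit Defensive.

Import GRing.Theory.

Local Open Scope classical_set_scope.
Local Open Scope ring_scope.

(* [N] is the internal direct sum of the additive subgroups [A i].  The index
   type may be infinite, so sums run over finite duplicate-free lists. *)
Definition is_direct_sum (I : choiceType) (V : zmodType)
    (N : set V) (A : I -> set V) : Prop :=
  [/\ forall i, zmod_closed (mem (A i)),
      N = [set x | exists s : seq I, exists f : I -> V,
             [/\ uniq s, forall i, A i (f i) & x = \sum_(i <- s) f i]]
    & forall (s : seq I) (f : I -> V),
        uniq s -> (forall i, A i (f i)) -> \sum_(i <- s) f i = 0 ->
        forall i, i \in s -> f i = 0].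

Definition graded_ring (G : groupType) (R : pzRingType) (Rg : G -> set R) :
    Prop :=
  is_direct_sum setT Rg /\
  forall (g h : G) (a b : R), Rg g a -> Rg h b -> Rg (g * h)%g (a * b).

Definition graded_module (G : groupType) (R : pzRingType) (M : lmodType R)
    (Rg : G -> set R) (Mg : G -> set M) : Prop :=
  is_direct_sum setT Mg /\
  forall (g h : G) (a : R) (m : M),
    Rg g a -> Mg h m -> Mg (g * h)%g (a *: m).

Definition homogeneous (G : groupType) (V : zmodType) (A : G -> set V) :
    set V :=
  \bigcup_g A g.

(* Rings are not assumed commutative; ideals are two-sided. *)
Definition is_ideal (R : pzRingType) (I : set R) : Prop :=
  zmod_closed (mem I) /\ forall r a : R, I a -> I (r * a) /\ I (a * r).

Definition graded_ideal (G : groupType) (R : pzRingType) (Rg : G -> set R)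
    (I : set R) : Prop :=
  is_ideal I /\ is_direct_sum I (fun g => I `&` Rg g).

Definition graded_submodule (G : groupType) (R : pzRingType) (M : lmodType R)
    (Mg : G -> set M) (N : set M) : Prop :=
  submod_closed (mem N) /\ is_direct_sum N (fun g => N `&` Mg g).

Definition colon (R : pzRingType) (M : lmodType R) (N : set M) : set R :=
  [set r | forall m : M, N (r *: m)].

Definition faithful_module (R : pzRingType) (M : lmodType R) : Prop :=
  [set r : R | forall m : M, r *: m = 0] = [set 0].

(* The submodule IM consists of the finite sums of products. *)
Definition ideal_mul (R : pzRingType) (M : lmodType R) (I : set R) : set M :=
  [set x | exists s : seq (R * M),
     (forall p, p \in s -> I p.1) /\ x = \sum_(p <- s) p.1 *: p.2].

Arguments ideal_mul {R} M I.

Definition graded_multiplication (G : groupType) (R : pzRingType)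
    (M : lmodType R) (Rg : G -> set R) (Mg : G -> set M) : Prop :=
  forall N : set M, graded_submodule Mg N ->
    exists I : set R, graded_ideal Rg I /\ N = ideal_mul M I.

Definition graded_prime_ideal (G : groupType) (R : pzRingType)
    (Rg : G -> set R) (B : set R) : Prop :=
  [/\ graded_ideal Rg B,
      B <> setT
    & forall a b : R, homogeneous Rg a -> homogeneous Rg b ->
        B (a * b) -> B a \/ B b].

Definition graded_prime_submodule (G : groupType) (R : pzRingType)
    (M : lmodType R) (Rg : G -> set R) (Mg : G -> set M) (P : set M) : Prop :=
  [/\ graded_submodule Mg P,
      P <> setT
    & forall (r : R) (m : M), homogeneous Rg r -> homogeneous Mg m ->
        P (r *: m) -> P m \/ colon P r].

Definition graded_semi_essential_ideal (G : groupType) (R : pzRingType)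
    (Rg : G -> set R) (I : set R) : Prop :=
  [/\ graded_ideal Rg I,
      I <> [set 0]
    & forall B : set R, graded_prime_ideal Rg B -> B <> [set 0] ->
        I `&` B <> [set 0]].

Definition graded_semi_essential_submodule (G : groupType) (R : pzRingType)
    (M : lmodType R) (Rg : G -> set R) (Mg : G -> set M) (K : set M) : Prop :=
  [/\ graded_submodule Mg K,
      K <> [set 0]
    & forall P : set M, graded_prime_submodule Rg Mg P -> P <> [set 0] ->
        K `&` P <> [set 0]].

(* Main.v *)
Require Import Defs.
From mathcomp Require Import all_boot all_algebra.
From mathcomp Require Import boolp classical_sets.

(** If [P] is a nonzero graded prime submodule, then [(P :_R M)] is a graded
    prime ideal, and it is nonzero since [P = IM] forces [0 <> I] and
    [I <= (P :_R M)]. So [(K :_R M)] and [(P :_R M)] share some [r <> 0]; then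
    [rM] lies in the intersection of [K] and [P], and it is nonzero because [M]
    is faithful. *)

Set Implicit Arguments.
Unset Strict Implicit.
Unset Printing Implicit Defensive.

Import GRing.Theory.

Local Open Scope classical_set_scope.
Local Open Scope ring_scope.

Lemma zmod_closed_set (V : zmodType) (A : set V) :
  zmod_closed (mem A) <-> A 0 /\ forall x y, A x -> A y -> A (x - y).
Proof.
split=> [[A0 AB]|[A0 AB]].
  split=> [|x y Ax Ay]; first exact: set_mem A0.
  by apply: set_mem; apply: AB; exact: mem_set.
split=> [|x y xA yA]; first exact: mem_set.
by apply: mem_set; apply: AB; exact: set_mem.
Qed.

Lemma zmod_closed_sum (V : zmodType) (A : set V) (I : eqType) (s : seq I)
    (f : I -> V) :
  zmod_closed (mem A) -> (forall i, i \in s -> A (f i)) ->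
  A (\sum_(i <- s) f i).
Proof.
move=> /zmod_closed_set[A0 AB] Af.
have AD x y : A x -> A y -> A (x + y).
  by move=> Ax Ay; rewrite -[y]opprK -[- y]sub0r; apply: (AB) => //; apply: AB.
by rewrite big_seq; apply: big_ind.
Qed.

Lemma submod_closed_zmod (R : pzRingType) (M : lmodType R) (N : set M) :
  submod_closed (mem N) -> zmod_closed (mem N).
Proof.
move=> [N0 Nlin]; split=> // x y xN yN.
by rewrite addrC -scaleN1r; exact: Nlin.
Qed.

Lemma submod_closed_scale (R : pzRingType) (M : lmodType R) (N : set M) r m :
  submod_closed (mem N) -> N m -> N (r *: m).
Proof.
move=> [N0 Nlin] Nm; rewrite -[r *: m]addr0.
by apply: set_mem; apply: Nlin => //; exact: mem_set.
Qed.

Lemma nonzero_elt (V : zmodType) (A : set V) :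
  A 0 -> A <> [set 0] -> exists2 x, A x & x <> 0.
Proof.
move=> A0 An0; apply: contrapT => noA; apply: An0.
apply/seteqP; split=> [x Ax|x ->//]; apply: contrapT => xn0.
by apply: noA; exists x.
Qed.

(** Uniqueness of components: an element of [P] also decomposes with summands in the [P]&[A i], and
    independence of the [A i] forces the two decompositions to agree. *)
Lemma direct_sum_component (I : choiceType) (V : zmodType) (P : set V)
    (A : I -> set V) (s : seq I) (f : I -> V) :
  is_direct_sum setT A -> is_direct_sum P (fun i => P `&` A i) ->
  uniq s -> (forall i, A i (f i)) -> P (\sum_(i <- s) f i) ->
  forall i, i \in s -> P (f i).
Proof.
move=> [Az _ Aind] [Pz PE _] us Af Ps i si.
have := Ps; rewrite {1}PE => -[t [e [ut Pe sum_eq]]].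
(* Padding both families by zero lets the two sums run over the common duplicate-free list
   [undup (s ++ t)], where their difference vanishes. *)
pose F j := (if j \in s then f j else 0) - (if j \in t then e j else 0).
have restrict_sum (r : seq I) (h : I -> V) : uniq r -> {subset r <= undup (s ++ t)} ->
    \sum_(j <- undup (s ++ t)) (if j \in r then h j else 0) = \sum_(j <- r) h j.
  move=> ur sub; rewrite -big_mkcond -big_filter; apply: perm_big.
  apply: uniq_perm => //; first by rewrite filter_uniq ?undup_uniq.
  by move=> j; rewrite mem_filter andbC; case: (boolP (j \in r)) => [/sub->|];
    rewrite ?andbF.
have F0 : F i = 0.
  apply: (Aind (undup (s ++ t))); first exact: undup_uniq.
  - move=> j; have /zmod_closed_set[A0 AB] := Az j.
    by apply: AB; case: ifP => // _; case: (Pe j).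
  - rewrite sumrB !restrict_sum // ?sum_eq ?subrr // => j jr;
      by rewrite mem_undup mem_cat jr ?orbT.
  - by rewrite mem_undup mem_cat si.
(* Thus [f i] is [e i], or zero if [i] is not in [t]; both lie in [P]. *)
move/eqP: F0; rewrite /F si subr_eq0 => /eqP->.
have /zmod_closed_set[[P0 _] _] := Pz i.
by case: ifP => // _; case: (Pe i).
Qed.

Section Colon.
Context (G : groupType) (R : pzRingType) (Rg : G -> set R).
Context (M : lmodType R) (Mg : G -> set M).
Hypotheses (hR : graded_ring Rg) (hM : graded_module Rg Mg).

Lemma colon_is_ideal (P : set M) : submod_closed (mem P) -> is_ideal (colon P).
Proof.
move=> Psub.
have /zmod_closed_set[P0 PB] := submod_closed_zmod Psub.
split.
  apply/zmod_closed_set; split=> [m|x y Px Py m]; first by rewrite scale0r.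
  by rewrite scalerBl; apply: PB.
move=> r a Pa; split=> m; rewrite -scalerA //.
exact: submod_closed_scale.
Qed.

(** Every [m] is a finite sum of homogeneous elements, and [P] is closed under sums. Here [r] itself
    need not be homogeneous. *)
Lemma colon_homogeneous (P : set M) (r : R) :
  submod_closed (mem P) ->
  (forall h m, Mg h m -> P (r *: m)) -> colon P r.
Proof.
move=> Psub Pr m; have [[_ ME _] _] := hM.
have : [set: M] m by [].
rewrite ME => -[t [e [_ Me ->]]]; rewrite scaler_sumr.
apply: zmod_closed_sum; first exact: submod_closed_zmod.
by move=> j _; apply: Pr.
Qed.

Lemma colon_graded (P : set M) :
  graded_submodule Mg P -> graded_ideal Rg (colon P).
Proof.
move=> [Psub Pdir]; have idP := colon_is_ideal Psub.
have [/zmod_closed_set[B0 BB] _] := idP.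
have [[Rz RE Rind] _] := hR; have [Mdir Msc] := hM.
split=> //; split.
- move=> g; have /zmod_closed_set[g0 gB] := Rz g.
  apply/zmod_closed_set; split=> // x y [Bx gx] [By gy].
  by split; [exact: BB|exact: gB].
- apply/seteqP; split=> [a Ba|a [s [f [_ Bf ->]]]]; last first.
    by apply: zmod_closed_sum; [case: idP|move=> i _; case: (Bf i)].
  have : [set: R] a by [].
  rewrite RE => -[s [f [us Rf aE]]].
  have Bf i : i \in s -> colon P (f i).
    move=> si; apply: colon_homogeneous => // h m Mm.
    (* For [m] of degree [h], the terms [f i *: m] of [a *: m] have degrees [i * h], pairwise
       distinct because right translation by [h] is injective. They are therefore the components of
       an element of the graded submodule [P]. The family is indexed by the degree [k = i * h],
       whence the factor [h^-1]. *)
    have := @direct_sum_component _ _ P Mg [seq (i * h)%g | i <- s]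
      (fun k => f (k * h^-1)%g *: m) Mdir Pdir.
    move=> /(_ _ _ _ (i * h)%g); rewrite mulgK; apply.
    + by rewrite map_inj_uniq //; exact: mulIg.
    + by move=> k; rewrite -[X in Mg X](mulgVK h); apply: Msc.
    + rewrite big_map; under eq_bigr do rewrite mulgK.
      by rewrite -scaler_suml -aE.
    + by apply/mapP; exists i.
  (* The family must lie in [colon P] at every index, but [f] is only known to do so on [s]. *)
  exists s, (fun i => if i \in s then f i else 0); split=> //.
    move=> i; case: ifP => [/Bf //|_]; split=> //.
    by have /zmod_closed_set[] := Rz i.
  by rewrite aE !big_seq; apply: eq_bigr => i ->.
- by move=> s f us Bf; apply: Rind => // i; case: (Bf i).
Qed.

Lemma colon_prime (P : set M) :
  graded_prime_submodule Rg Mg P -> graded_prime_ideal Rg (colon P).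
Proof.
move=> [Pgr PnT Ppr]; split; first exact: colon_graded.
  (* If [1] were in [colon P], then [P] would be all of [M]. *)
  move=> BT; apply: PnT; apply/seteqP; split=> // m _.
  have : colon P 1 by rewrite BT.
  by move=> /(_ m); rewrite scale1r.
move=> a b ha [g _ gb] Bab.
have [Ba|nBa] := pselect (colon P a); [by left|right].
apply: colon_homogeneous; first by case: Pgr.
(* Primeness of [P] is applied to [a] and the homogeneous element [b *: m]; as [a] is not in
   [colon P], it yields [b *: m] in [P]. *)
move=> h m Mm; have [] // := Ppr a (b *: m) ha.
  by exists (g * h)%g => //; apply: hM.2.
by rewrite scalerA.
Qed.

Lemma colon_neq0 (P : set M) :
  graded_multiplication Rg Mg -> graded_submodule Mg P -> P <> [set 0] ->
  colon P <> [set 0].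
Proof.
move=> hmul Pgr Pn0 B0; have [I [_ PE]] := hmul P Pgr.
have IB r : I r -> colon P r.
  move=> Ir m; rewrite PE; exists [:: (r, m)]; rewrite big_seq1.
  by split=> // p; rewrite inE => /eqP->.
have [/submod_closed_zmod/zmod_closed_set[P0 _] _] := Pgr.
apply: Pn0; apply/seteqP; split=> [x|x ->//].
rewrite PE => -[s [Is ->]]; rewrite big_seq big1 // => p /Is/IB.
by rewrite B0 => ->; rewrite scale0r.
Qed.

End Colon.

Lemma faithful_nonzero (R : pzRingType) (M : lmodType R) (N : set M) (r : R) :
  faithful_module M -> colon N r -> r <> 0 -> N <> [set 0].
Proof.
move=> hfaith Nr rn0 N0; apply: rn0.
suff : [set r : R | forall m : M, r *: m = 0] r by rewrite hfaith.
by move=> m; have := Nr m; rewrite N0.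
Qed.

Theorem proposition5p14 (G : groupType) (R : pzRingType) (Rg : G -> set R)
    (M : lmodType R) (Mg : G -> set M) (K : set M)
    (hR : graded_ring Rg) (hM : graded_module Rg Mg)
    (hmul : graded_multiplication Rg Mg) (hfaith : faithful_module M)
    (hK : graded_submodule Mg K)
    (hKM : graded_semi_essential_ideal Rg (colon K)) :
  graded_semi_essential_submodule Rg Mg K.
Proof.
have [[[/zmod_closed_set[K0 _] _] _] Kn0 Kess] := hKM.
split=> //.
  have [r Kr rn0] := nonzero_elt K0 Kn0.
  exact: faithful_nonzero Kr rn0.
move=> P Ppr Pn0; have [Pgr _ _] := Ppr.
have Bpr := colon_prime hR hM Ppr.
have [[[/zmod_closed_set[B0 _] _] _] _ _] := Bpr.
have [//|r [Kr Br] rn0] := nonzero_elt _ (Kess _ Bpr (colon_neq0 hmul Pgr Pn0)).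
(* Lying in both colon ideals, [r] lies in the colon of the intersection of [K] and [P]. *)
by apply: (@faithful_nonzero _ _ _ r) => // m; split.
Qed.
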